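(* Let $A\subset\mathbb{R}^d$ be a bounded set such that $\overline{\dim}_B(A)<t<(d-1)/2$ and let $2t<w<d-1$. Then the set of points $h\in\mathbb{R}^d\setminus A$ for which $A$ is not contained in the graph, in polar coordinates centered at $h$, of a H\''older function $f_h\colon S^{d-1}\to(0,\infty)$ of exponent $1-\frac{2t}{w}$ has Hausdorff dimension at most $w+1$.
   Context: $\overline{\dim}_B$ denotes upper box counting dimension. Polar coordinates centered at $h$ identify the point $h+sv\in\mathbb{R}^d\setminus\{h\}$, where $v\in S^{d-1}$ and $s>0$, with the pair $(v,s)\in S^{d-1}\times(0,\infty)$; thus the graph of $f\colon S^{d-1}\to(0,\infty)$ in polar coordinates centered at $h$ is $\{h+f(v)v: v\in S^{d-1}\}$. A function $f$ is H\''older of exponent $\alpha$ if there is $C$ with $|f(v)-f(v')|\le C|v-v'|^\alpha$ for all $v,v'$. *)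

(* Defs.v *)
From HB Require Import structures.
From mathcomp Require Import all_boot all_order all_algebra.
From mathcomp Require Import all_classical all_reals all_analysis.

Set Implicit Arguments.
Unset Strict Implicit.
Unset Printing Implicit Defensive.

Import Order.TTheory GRing.Theory Num.Theory.
Import numFieldNormedType.Exports.

Local Open Scope classical_set_scope.
Local Open Scope ring_scope.

(* The library norm on row vectors is the sup norm, which would give the wrong
   unit sphere. *)
Definition enorm (R : realType) (d : nat) (x : 'rV[R]_d) : R :=
  Num.sqrt (\sum_(i < d) x ord0 i ^+ 2).

Definition unit_sphere (R : realType) (d : nat) : set 'rV[R]_d :=
  [set v | enorm v = 1].

(* Pitfall: [diam set0 = -oo]. *)
Definition diam (R : realType) (d : nat) (U : set 'rV[R]_d) : \bar R :=
  ereal_sup [set (enorm (p.1 - p.2))%:E | p in U `*` U].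

(* Smallest number of sets of diameter at most [delta] covering [A], [+oo] if
   there is no such finite cover. *)
Definition covering_number (R : realType) (d : nat) (A : set 'rV[R]_d)
    (delta : R) : \bar R :=
  ereal_inf [set n%:R%:E | n in [set n : nat |
    exists U : 'I_n -> set 'rV[R]_d,
      (forall i, (diam (U i) <= delta%:E)%E) /\
      A `<=` \bigcup_(i in [set: 'I_n]) U i]].

(* limsup of log N(delta) / - log delta as delta tends to 0 from above. The
   empty set has dimension 0 by convention (the limsup would be [-oo]). *)
Definition upper_box_dim (R : realType) (d : nat) (A : set 'rV[R]_d) : \bar R :=
  if A == set0 then 0%E
  else limf_esup
    (fun delta : R => (lne (covering_number A delta) * ((- ln delta)^-1)%:E)%E)
    (0 : R)^'+.

(* |U|^s, where the empty set counts for 0 even if s = 0. For s = 0 and U a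
   singleton the value is 1, so that the 0-dimensional Hausdorff measure is the
   counting measure. *)
Definition diam_pow (R : realType) (d : nat) (s : R) (U : set 'rV[R]_d) :
    \bar R :=
  if U == set0 then 0%E else poweR (diam U) s.

Definition hausdorff_premeasure (R : realType) (d : nat) (s delta : R)
    (A : set 'rV[R]_d) : \bar R :=
  ereal_inf [set (\sum_(0 <= i <oo) diam_pow s (U i))%E |
    U in [set U : nat -> set 'rV[R]_d |
      (forall i, (diam (U i) <= delta%:E)%E) /\
      A `<=` \bigcup_(i in [set: nat]) U i]].

(* The premeasure is nonincreasing in delta, so the supremum is its limit as
   delta tends to 0. *)
Definition hausdorff_measure (R : realType) (d : nat) (s : R)
    (A : set 'rV[R]_d) : \bar R :=
  ereal_sup [set hausdorff_premeasure s delta A | delta in [set delta : R | 0 < delta]].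

Definition hausdorff_dim (R : realType) (d : nat) (A : set 'rV[R]_d) : \bar R :=
  ereal_inf [set s%:E | s in [set s : R | 0 <= s /\ hausdorff_measure s A = 0%E]].

(* Functions on the sphere are represented by functions on the whole space, of
   which only the values on the sphere matter. *)
Definition sphere_holder (R : realType) (d : nat) (alpha : R)
    (f : 'rV[R]_d -> R) : Prop :=
  exists C : R, forall v v', unit_sphere v -> unit_sphere v' ->
    `|f v - f v'| <= C * powR (enorm (v - v')) alpha.

Definition polar_graph (R : realType) (d : nat) (h : 'rV[R]_d)
    (f : 'rV[R]_d -> R) : set 'rV[R]_d :=
  [set h + f v *: v | v in @unit_sphere R d].

Definition in_polar_holder_graph (R : realType) (d : nat) (alpha : R)
    (A : set 'rV[R]_d) (h : 'rV[R]_d) : Prop :=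
  exists f : 'rV[R]_d -> R,
    [/\ forall v, unit_sphere v -> 0 < f v,
        sphere_holder alpha f &
        A `<=` polar_graph h f].

(* Main.v *)
Require Import Defs.
From mathcomp Require Import all_boot all_order all_algebra.
From mathcomp Require Import all_classical all_reals all_analysis.
From mathcomp Require Import ring lra.
Import Order.TTheory GRing.Theory Num.Theory.
Import numFieldNormedType.Exports.
Local Open Scope classical_set_scope.
Local Open Scope ring_scope.

(* Put alpha = 1 - 2t/w and beta = 1/alpha. If h is not adherent to A and
   | |a - h| - |a' - h| | <= C theta^alpha for all a, a' in A, where theta is the
   distance between the directions of a and a' seen from h, then McShane's
   extension gives f_h. Otherwise, for every c > 0 (with C = c^(-alpha)) some pair
   at distance about rho has theta <= c rho^beta, so h lies within a constant
   times delta = c rho^(beta - 1) of the line through a and a'. Covering A by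
   eta^(-tau) pieces of diameter eta = delta rho, with tau < t, and cutting the
   tube of each pair of pieces into about 1/delta parts of diameter about delta,
   the cost in dimension w + 1 at scale rho is of order
   eta^(-2 tau) delta^w = c^(w - 2 tau) rho^(2 (t - tau) beta). This is summable
   over dyadic rho, and the sum tends to 0 with c. *)

Section euclidean_norm.
Context {R : realType} {d : nat}.
Implicit Types (x y z : 'rV[R]_d).

Lemma sum_sq_ge0 x : 0 <= \sum_(i < d) x ord0 i ^+ 2.
Proof. by apply: sumr_ge0 => i _; exact: sqr_ge0. Qed.

Lemma enorm_ge0 x : 0 <= enorm x.
Proof. exact: sqrtr_ge0. Qed.

Lemma enorm_sq x : enorm x ^+ 2 = \sum_(i < d) x ord0 i ^+ 2.
Proof. by rewrite sqr_sqrtr// sum_sq_ge0. Qed.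

Lemma enormZ (k : R) x : enorm (k *: x) = `|k| * enorm x.
Proof.
rewrite /enorm -sqrtr_sqr -sqrtrM ?sqr_ge0// mulr_sumr.
by congr Num.sqrt; apply: eq_bigr => i _; rewrite mxE exprMn.
Qed.

Lemma enormN x : enorm (- x) = enorm x.
Proof. by rewrite -scaleN1r enormZ normrN1 mul1r. Qed.

Lemma enorm_subC x y : enorm (x - y) = enorm (y - x).
Proof. by rewrite -enormN opprB. Qed.

Lemma enorm0 : enorm (0 : 'rV[R]_d) = 0.
Proof. by rewrite -(scale0r 0) enormZ normr0 mul0r. Qed.

Lemma enorm_gt0 x : x != 0 -> 0 < enorm x.
Proof.
move=> x0; rewrite lt_neqAle enorm_ge0 andbT eq_sym.
apply: contra x0 => /eqP e0; apply/eqP/rowP => i.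
have := enorm_sq x; rewrite e0 expr0n/= => /esym /psumr_eq0P h.
apply/eqP; rewrite mxE -sqrf_eq0; apply/eqP.
by rewrite h// => j _; exact: sqr_ge0.
Qed.

Lemma enorm_cauchy_schwarz x y :
  \sum_(i < d) x ord0 i * y ord0 i <= enorm x * enorm y.
Proof.
have [->|x0] := eqVneq x 0.
  by rewrite big1 ?enorm0 ?mul0r// => i _; rewrite mxE mul0r.
have [->|y0] := eqVneq y 0.
  by rewrite big1 ?enorm0 ?mulr0// => i _; rewrite mxE mulr0.
have X0 := enorm_gt0 _ x0; have Y0 := enorm_gt0 _ y0.
set X := enorm x in X0 *; set Y := enorm y in Y0 *.
have : 0 <= \sum_(i < d) (Y * x ord0 i - X * y ord0 i) ^+ 2.
  by apply: sumr_ge0 => i _; exact: sqr_ge0.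
rewrite (eq_bigr (fun i => Y ^+ 2 * x ord0 i ^+ 2 + X ^+ 2 * y ord0 i ^+ 2
   - (2 * X * Y) * (x ord0 i * y ord0 i))); last by move=> i _; ring.
rewrite sumrB big_split/= -!mulr_sumr -!enorm_sq -/X -/Y.
rewrite (_ : Y ^+ 2 * X ^+ 2 + _ = 2 * X * Y * (X * Y)); last by ring.
by rewrite -mulrBr pmulr_rge0 ?subr_ge0// !mulr_gt0.
Qed.

Lemma enormD x y : enorm (x + y) <= enorm x + enorm y.
Proof.
rewrite -ler_sqr ?nnegrE ?addr_ge0 ?enorm_ge0// enorm_sq.
rewrite (eq_bigr (fun i => x ord0 i ^+ 2 + y ord0 i ^+ 2
   + 2 * (x ord0 i * y ord0 i))); last by move=> i _; rewrite mxE; ring.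
rewrite !big_split/= -mulr_sumr -!enorm_sq.
have := enorm_cauchy_schwarz x y; nra.
Qed.

Lemma enormB x y : enorm (x - y) <= enorm x + enorm y.
Proof. by rewrite -(enormN y) enormD. Qed.

Lemma enorm_distD z x y : enorm (x - y) <= enorm (x - z) + enorm (z - y).
Proof. by rewrite -[x - y](subrKA z) enormD. Qed.

Lemma enorm_le_norm x : enorm x <= d%:R * `|x|.
Proof.
rewrite -ler_sqr ?nnegrE ?mulr_ge0 ?enorm_ge0// enorm_sq.
apply: (@le_trans _ _ (\sum_(i < d) `|x| ^+ 2)).
  apply: ler_sum => i _; rewrite -(real_normK (num_real (x ord0 i))).
  rewrite ler_sqr ?nnegrE//.
  rewrite [leRHS]/Num.norm/= mx_normrE.
  by apply: (le_bigmax _ (fun ij : 'I_1 * 'I_d => `|x ij.1 ij.2|) (ord0, i)).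
rewrite sumr_const card_ord exprMn -[leLHS]mulr_natl ler_wpM2r ?sqr_ge0//.
rewrite -natrX ler_nat; by case: (d) => // n; rewrite -{1}[n.+1]muln1 leq_mul2l.
Qed.

End euclidean_norm.

Section powR_facts.
Context {R : realType}.
Implicit Types (x y p : R).

Lemma powR_subadditive p x y : 0 < p -> p <= 1 -> 0 <= x -> 0 <= y ->
  (x + y) `^ p <= x `^ p + y `^ p.
Proof.
move=> p0 p1 x0 y0.
have [s0|] := ltP 0 (x + y); last first.
  move=> s0; have -> : x + y = 0 by apply: le_anti; rewrite s0 addr_ge0.
  by rewrite powR0 ?gt_eqF// addr_ge0 ?powR_ge0.
have key z : 0 <= z -> z <= x + y -> z / (x + y) * (x + y) `^ p <= z `^ p.
  rewrite le_eqVlt => /predU1P[<-|z0] zs; first by rewrite !mul0r powR_ge0.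
  have zs1 : 0 < z / (x + y) <= 1.
    by rewrite divr_gt0//= ler_pdivrMr ?mul1r.
  rewrite -[in leRHS](divfK (lt0r_neq0 s0) z) powRM ?(ltW s0)//; last first.
    by case/andP: zs1 => /ltW.
  by rewrite ler_wpM2r ?powR_ge0// ger1_powR.
have kx := key x x0; have ky := key y y0.
apply: le_trans (lerD (kx _) (ky _)); [|lra|lra].
by rewrite -mulrDl -mulrDl divff ?mul1r ?lt0r_neq0.
Qed.

End powR_facts.

Section hausdorff.
Context {R : realType} {d : nat}.
Implicit Types (U E : set 'rV[R]_d) (s : R) (e : \bar R).

Lemma diam_le U (r : R) : (forall x y, U x -> U y -> enorm (x - y) <= r) ->
  (diam U <= r%:E)%E.
Proof.
move=> h; apply: ge_ereal_sup => _ [[x y] [/= Ux Uy] <-].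
by rewrite lee_fin h.
Qed.

Lemma enorm_le_diam U (r : R) x y : (diam U <= r%:E)%E -> U x -> U y ->
  enorm (x - y) <= r.
Proof.
move=> h Ux Uy; rewrite -lee_fin; apply: le_trans h.
by apply: ereal_sup_ubound; exists (x, y).
Qed.

Lemma diam_pow_ge0 s U : (0 <= diam_pow s U)%E.
Proof.
rewrite /diam_pow; case: ifP => // _.
by case: (diam U) => [r| |]/=; rewrite ?lee_fin ?powR_ge0//; case: ifP.
Qed.

Lemma diam_pow0 s : diam_pow s (set0 : set 'rV[R]_d) = 0%E.
Proof. by rewrite /diam_pow eqxx. Qed.

Lemma diam_pow_le s U (r : R) : 0 <= s -> 0 <= r -> (diam U <= r%:E)%E ->
  (diam_pow s U <= (r `^ s)%:E)%E.
Proof.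
move=> s0 r0; rewrite /diam_pow; case: ifPn => [_ _|/set0P[x Ux]].
  by rewrite lee_fin powR_ge0.
have : (0 <= diam U)%E.
  by apply: ereal_sup_ubound; exists (x, x) => //=; rewrite subrr enorm0.
case: (diam U) => [q| |]//=; rewrite !lee_fin => q0 qr.
by apply: ge0_ler_powR.
Qed.

Lemma diam_le_of_diam_pow s U (r : R) : 0 < s -> 0 <= r ->
  (diam_pow s U <= (r `^ s)%:E)%E -> (diam U <= r%:E)%E.
Proof.
move=> s0 r0; rewrite /diam_pow; case: ifPn => [/eqP -> _|/set0P[x Ux]].
  by apply: diam_le.
have : (0 <= diam U)%E.
  by apply: ereal_sup_ubound; exists (x, x) => //=; rewrite subrr enorm0.
case: (diam U) => [q| |]//=; last by rewrite gt_eqF.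
rewrite !lee_fin => q0; apply: contraTT; rewrite -!ltNge => rq.
by apply: gt0_ltr_powR.
Qed.

Definition covered_at_cost s E e := exists U : nat -> set 'rV[R]_d,
  E `<=` \bigcup_i U i /\ (\sum_(0 <= i <oo) diam_pow s (U i) <= e)%E.

Lemma covered_at_costW {s E} e E' e' : E' `<=` E -> (e <= e')%E ->
  covered_at_cost s E e -> covered_at_cost s E' e'.
Proof.
move=> EE ee [U [EU Ue]]; exists U; split; first exact: subset_trans EU.
exact: le_trans ee.
Qed.

Lemma hausdorff_measure_eq0 s E : 0 < s ->
  (forall e : R, 0 < e -> covered_at_cost s E e%:E) ->
  hausdorff_measure s E = 0%E.
Proof.
move=> s0 cov; apply/eqP; rewrite eq_le; apply/andP; split.
  apply: ge_ereal_sup => _ [r /= r0 <-].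
  apply/lee_addgt0Pr => e e0; rewrite add0e.
  have m0 : 0 < Num.min e (r `^ s) by rewrite lt_min e0 powR_gt0.
  have [U [EU Ue]] := cov _ m0.
  apply: (@le_trans _ _ (\sum_(0 <= i <oo) diam_pow s (U i))%E); last first.
    by rewrite (le_trans Ue)// lee_fin ge_min lexx.
  apply: ereal_inf_lbound; exists U => //; split => // i.
  apply: (@diam_le_of_diam_pow s) => //; first exact: ltW.
  apply: le_trans (le_trans Ue _); last by rewrite lee_fin ge_min lexx orbT.
  rewrite (nneseriesD1 (n := i))//; last by move=> *; exact: diam_pow_ge0.
  by rewrite leeDl// nneseries_ge0// => *; exact: diam_pow_ge0.
apply: (@le_trans _ _ (hausdorff_premeasure s 1 E)).
  apply: le_ereal_inf_tmp => _ [U _ <-].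
  by apply: nneseries_ge0 => i _ _; exact: diam_pow_ge0.
by apply: ereal_sup_ubound; exists 1 => //=.
Qed.

Lemma covered_at_cost_bigcup s (E : nat -> set 'rV[R]_d) (e : nat -> \bar R) :
  (forall n, covered_at_cost s (E n) (e n)) ->
  covered_at_cost s (\bigcup_n E n) (\sum_(0 <= n <oo) e n)%E.
Proof.
move=> /choice[U HU].
have /card_set_bijP[f fbij] : ([set: nat] #= [set: nat * nat])%card.
  by rewrite card_eq_sym card_nat2.
exists (fun k => U (f k).1 (f k).2); split.
  move=> x [n _ /(HU n).1 [i _ Ui]].
  by have [_ _ /(_ (n, i) I) [k _ fk]] := fbij; exists k => //; rewrite fk.
have p0 V : (0 <= diam_pow s V)%E := diam_pow_ge0 s V.
rewrite nneseries_esumT//.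
rewrite -(reindex_esum [set: nat] [set: nat * nat] f (fun p => diam_pow s (U p.1 p.2)))//.
rewrite (_ : [set: nat * nat] = [set: nat] `*`` (fun=> setT)); last first.
  by apply/seteqP; split.
rewrite -(esum_esum (a := fun i j => diam_pow s (U i j)))//.
rewrite -nneseries_esumT; last by move=> n; exact: esum_ge0.
apply: lee_nneseries => [n _ _|n _]; first exact: esum_ge0.
by rewrite -nneseries_esumT//; exact: (HU n).2.
Qed.

Lemma covered_at_cost_fin s (T : finType) (U : T -> set 'rV[R]_d) (r : R) :
  0 <= s -> 0 <= r -> (forall i, (diam (U i) <= r%:E)%E) ->
  covered_at_cost s (\bigcup_i U i) (#|T|%:R * r `^ s)%:E.
Proof.
move=> s0 r0 Ur.
pose V k := if insub k is Some i then U (enum_val (i : 'I_#|T|)) else set0.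
exists V; split.
  move=> x [i _ Ui]; exists (enum_rank i) => //.
  by rewrite /V valK enum_rankK.
rewrite (nneseries_split 0 #|T|)/=; last by move=> *; exact: diam_pow_ge0.
rewrite add0n [X in (_ + X)%E]eseries0 ?adde0; last first.
  by move=> k Tk _; rewrite /V insubF ?diam_pow0// ltnNge Tk.
rewrite big_mkord; apply: (@le_trans _ _ (\sum_(i < #|T|) (r `^ s)%:E)%E).
  by apply: lee_sum => i _; apply: diam_pow_le => //; rewrite /V valK.
by rewrite sumEFin sumr_const card_ord mulr_natl.
Qed.

End hausdorff.

Section box.
Context {R : realType} {d : nat}.
Implicit Types (A : set 'rV[R]_d).

Definition box_covered A (tau delta0 : R) :=
  forall delta, 0 < delta -> delta < delta0 ->
  exists (n : nat) (U : 'I_n -> set 'rV[R]_d),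
    [/\ n%:R <= delta `^ (- tau), forall i, (diam (U i) <= delta%:E)%E
      & A `<=` \bigcup_i U i].

Lemma box_covered_exponent_ge0 A tau delta0 : A !=set0 -> 0 < delta0 ->
  delta0 <= 1 -> box_covered A tau delta0 -> 0 <= tau.
Proof.
move=> [a Aa] d0 d1 cov.
have [||n [U [nle _ AU]]] := cov (delta0 / 2); [lra|lra|].
have [i _ _] := AU _ Aa.
rewrite leNgt; apply/negP => tau0; move: nle; apply/negP; rewrite -ltNge.
apply: (@lt_le_trans _ _ 1); last by rewrite ler1n (leq_trans _ (ltn_ord i)).
have := @gt0_ltr_powR R (- tau) _ (delta0 / 2) 1; rewrite powR1.
by apply; rewrite ?nnegrE; lra.
Qed.

Lemma upper_box_dim_lt A (t : R) : A !=set0 -> (upper_box_dim A < t%:E)%E ->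
  exists tau delta0 : R, [/\ 0 <= tau, tau < t, 0 < delta0
    & box_covered A tau delta0].
Proof.
move=> A0; rewrite /upper_box_dim ifF; last first.
  by apply/negbTE/set0P.
move=> /ereal_inf_lt[_ [V V0 <-] supV].
have [t1 [supt1 t1t]] : exists t1 : R,
    (forall x, V x -> lne (covering_number A x) * ((- ln x)^-1)%:E <= t1%:E)%E
    /\ t1 < t.
  move: supV; set S := ereal_sup _.
  have ubS x : V x -> (lne (covering_number A x) * ((- ln x)^-1)%:E <= S)%E.
    by move=> Vx; apply: ereal_sup_ubound; exists x.
  case: S ubS => [u| |]// ubS; first by rewrite lte_fin; exists u.
  move=> _; exists (t - 1); split; last by lra.
  by move=> x /ubS /le_trans; apply; rewrite leNye.
move: V0 => /nbhs_ballP[e /= e0 he].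
have Vd x : 0 < x -> x < e -> V x.
  move=> x0 xe; apply: he => //=.
  by rewrite /ball/= sub0r normrN gtr0_norm.
have cov : box_covered A ((t1 + t) / 2) (Num.min e 1).
  move=> x x0; rewrite lt_min => /andP[xe x1].
  have l0 : 0 < - ln x by rewrite oppr_gt0 ln_lt0// x0.
  have : (covering_number A x < (x `^ (- ((t1 + t) / 2)))%:E)%E.
    rewrite ltNge; apply/negP => hN.
    have := supt1 _ (Vd _ x0 xe); rewrite lee_pdivrMr//; apply/negP.
    rewrite -ltNge.
    have p0 : (0 <= (x `^ (- ((t1 + t) / 2)))%:E)%E by rewrite lee_fin powR_ge0.
    apply: (@lt_le_trans _ _ (lne (x `^ (- ((t1 + t) / 2)))%:E)).
      rewrite lne_EFin ?powR_gt0// ln_powR -EFinM lte_fin; nra.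
    by rewrite lee_lne ?in_itv/= ?leey ?andbT// (le_trans p0 hN).
  move=> /ereal_inf_lt[_ [n [U [dU AU]] <-]]; rewrite lte_fin => nle.
  by exists n, U; split => //; exact: ltW.
have m0 : 0 < Num.min e 1 by rewrite lt_min e0 ltr01.
exists ((t1 + t) / 2), (Num.min e 1); split => //.
- by apply: box_covered_exponent_ge0 cov => //; rewrite ge_min lexx orbT.
- lra.
Qed.

End box.

Section polar.
Context {R : realType} {d : nat}.
Implicit Types (A : set 'rV[R]_d) (h a v : 'rV[R]_d).

Definition direction h a := (enorm (a - h))^-1 *: (a - h).

Lemma direction_unit h a : a != h -> unit_sphere (direction h a).
Proof.
rewrite -subr_eq0 => /enorm_gt0 ah.
by rewrite /unit_sphere/= enormZ normfV gtr0_norm// mulVf// gt_eqF.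
Qed.

Lemma directionK h a : a != h -> enorm (a - h) *: direction h a = a - h.
Proof.
rewrite -subr_eq0 => /enorm_gt0 ah.
by rewrite scalerA divff ?scale1r// gt_eqF.
Qed.

Lemma dist_maxr_le (r x y k : R) : x <= y + k -> y <= x + k -> 0 <= k ->
  `|Num.max r x - Num.max r y| <= k.
Proof.
move=> xy yx k0; rewrite ler_norml.
by case: (leP r x) => rx; case: (leP r y) => ry; apply/andP; split; lra.
Qed.

(* McShane's extension of [a |-> |a - h|], viewed as a function of the direction
   of [a - h], followed by a truncation that makes it positive. *)
Lemma in_polar_holder_graph_of_bound (alpha r C : R) A h :
  0 < alpha -> alpha <= 1 -> 0 < r -> 0 <= C ->
  (forall a, A a -> r <= enorm (a - h)) ->
  (forall a a', A a -> A a' -> enorm (a - h) - enorm (a' - h) <=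
     C * enorm (direction h a - direction h a') `^ alpha) ->
  in_polar_holder_graph alpha A h.
Proof.
move=> al0 al1 r0 C0 rA CA.
have [->|/set0P[b Ab]] := eqVneq A set0.
  exists (fun=> 1); split => //; exists 0 => v v' _ _.
  by rewrite subrr normr0 mul0r.
pose S v := [set enorm (a - h) + C * enorm (v - direction h a) `^ alpha | a in A].
have S0 v a : 0 <= enorm (a - h) + C * enorm (v - direction h a) `^ alpha.
  by rewrite addr_ge0 ?enorm_ge0// mulr_ge0 ?powR_ge0.
have infS v a : A a ->
    inf (S v) <= enorm (a - h) + C * enorm (v - direction h a) `^ alpha.
  move=> Aa; apply: ge_inf; last by exists a.
  by exists 0 => _ [a' _ <-].
have Slb v x : (forall a, A a ->
    x <= enorm (a - h) + C * enorm (v - direction h a) `^ alpha) -> x <= inf (S v).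
  move=> hx; apply: lb_le_inf; last by move=> _ [a Aa <-]; exact: hx.
  by eexists; exists b.
have lipS v v' : inf (S v) <= inf (S v') + C * enorm (v - v') `^ alpha.
  rewrite -lerBlDr; apply: Slb => a Aa; rewrite lerBlDr.
  apply: le_trans (infS v a Aa) _; rewrite -addrA lerD2l -mulrDr ler_wpM2l//.
  rewrite [leRHS]addrC; apply: le_trans (powR_subadditive _ _ _ al0 al1 _ _);
    rewrite ?enorm_ge0//.
  by apply: ge0_ler_powR; rewrite ?nnegrE ?addr_ge0 ?enorm_ge0 ?(ltW al0)// enorm_distD.
exists (fun v => Num.max r (inf (S v))); split.
- by move=> v _; rewrite lt_max r0.
- exists C => v v' _ _.
  apply: dist_maxr_le; first exact: lipS.
    by rewrite enorm_subC; exact: lipS.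
  by rewrite mulr_ge0 ?powR_ge0.
- move=> a Aa.
  have ah : a != h.
    apply: contraTneq (rA a Aa) => ->.
    by rewrite subrr enorm0 -ltNge.
  exists (direction h a); first exact: direction_unit.
  have -> : inf (S (direction h a)) = enorm (a - h).
    apply: le_anti; apply/andP; split.
      by apply: le_trans (infS _ _ Aa) _; rewrite subrr enorm0 powR0 ?gt_eqF// mulr0 addr0.
    by apply: Slb => a' Aa'; rewrite -lerBlDl; exact: CA.
  by rewrite max_r ?rA// directionK// subrKC.
Qed.

(* With [v], [v'] the directions and [x], [x'] the distances, the vector below
   is [(x / (x - x')) x' (v - v')]. *)
Lemma enorm_sub_line h a a' (lam := enorm (a - h) / (enorm (a - h) - enorm (a' - h))) :
  a != h -> a' != h -> enorm (a' - h) < enorm (a - h) ->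
  enorm (h - (a - lam *: (a - a'))) =
  lam * (enorm (a' - h) * enorm (direction h a - direction h a')).
Proof.
move=> ah a'h; set x := enorm (a - h) in lam *; set x' := enorm (a' - h) in lam *.
move=> xx'; have dx0 : 0 < x - x' by rewrite subr_gt0.
have lam0 : 0 <= lam by rewrite divr_ge0 ?enorm_ge0// ltW.
have -> : h - (a - lam *: (a - a')) =
    (lam * x') *: (direction h a - direction h a').
  have lamE : lam * x' = lam * x - x.
    by rewrite /lam; field; rewrite gt_eqF.
  move: lamE; clearbody lam => lamE.
  rewrite [RHS]scalerBr {1}lamE scalerBl -!scalerA.
  rewrite (directionK _ _ ah : x *: _ = _) (directionK _ _ a'h : x' *: _ = _).
  rewrite !scalerBr; apply/rowP => i; rewrite !mxE; ring.
by rewrite enormZ ger0_norm ?mulrA// mulr_ge0 ?enorm_ge0.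
Qed.

End polar.

Section small_scales.
Context {R : realType}.

Lemma near_powR_small (K p e : R) : 0 < p -> 0 < e ->
  \forall c \near 0^'+, K * c `^ p < e.
Proof.
move=> p0 e0.
have : K * c `^ p @[c --> 0^'+] --> K * 0 by apply: cvgMr; exact: powR_cvg0.
by rewrite mulr0 => /cvgr_lt; apply.
Qed.

Lemma dyadic_scale (D y : R) : 0 < y -> y <= D ->
  exists k, D / 2 ^+ k / 2 < y /\ y <= D / 2 ^+ k.
Proof.
move=> y0 yD.
have ex : exists m, D / 2 ^+ m < y.
  exists (Num.bound (D / y)); have := upper_nthrootP (leqnn (Num.bound (D / y))).
  by rewrite ltr_pdivrMr// mulrC -ltr_pdivrMr ?exprn_gt0.
have [[|k] km kmin] := ex_minnP ex.
  by move: km; rewrite expr0 divr1 ltNge yD.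
exists k; split; first by rewrite -mulrA -invfM -exprSr.
by rewrite leNgt; apply/negP => /kmin; rewrite ltnn.
Qed.

Lemma nneseries_geometric_le (a z : R) : 0 <= a -> 0 < z -> z < 1 ->
  (\sum_(0 <= k <oo) (a * z ^+ k)%:E <= (a / (1 - z))%:E)%E.
Proof.
move=> a0 z0 z1; apply: lime_le.
  by apply: is_cvg_nneseries => k _ _; rewrite lee_fin mulr_ge0// exprn_ge0// ltW.
apply: nearW => n; rewrite sumEFin lee_fin.
by apply: geometric_le_lim; rewrite ?gtr0_norm.
Qed.

End small_scales.

Section centers.
Context {R : realType} {d : nat}.
Implicit Types (A : set 'rV[R]_d) (h a : 'rV[R]_d).

Definition aligned_centers A (L rho eta : R) := [set h | exists a a',
  [/\ A a /\ A a', a != h /\ a' != h, enorm (a - h) <= L,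
      enorm (a' - h) < enorm (a - h) &
   [/\ rho / 2 < enorm (a - a'), enorm (a - a') <= rho &
    enorm (direction h a - direction h a') <= eta]]].

Lemma enorm_sub_le_direction h a a' : a != h -> a' != h ->
  enorm (a' - h) < enorm (a - h) ->
  enorm (a - a') <= enorm (a - h) - enorm (a' - h) +
    enorm (a' - h) * enorm (direction h a - direction h a').
Proof.
move=> ah a'h lt; have dx0 : 0 < enorm (a - h) - enorm (a' - h) by rewrite subr_gt0.
have -> : a - a' = (enorm (a - h) - enorm (a' - h)) *: direction h a
    + enorm (a' - h) *: (direction h a - direction h a').
  rewrite scalerBl scalerBr !directionK//.
  by rewrite subrKA opprB subrKA.
apply: le_trans (enormD _ _) _.
have du : enorm (direction h a) = 1 := direction_unit _ _ ah.
by rewrite (enormZ (_ - _)) (enormZ (enorm _)) du mulr1 !ger0_norm ?enorm_ge0// ltW.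
Qed.

Lemma aligned_centers_near_line L rho delta h a a'
    (lam := enorm (a - h) / (enorm (a - h) - enorm (a' - h))) :
  1 <= L -> 0 < rho -> 0 < delta -> delta * L <= 1 / 4 ->
  a != h -> a' != h -> enorm (a - h) <= L -> enorm (a' - h) < enorm (a - h) ->
  rho / 2 < enorm (a - a') ->
  enorm (direction h a - direction h a') <= delta * rho ->
  [/\ 0 <= lam, lam <= 4 * L / rho &
    enorm (h - (a - lam *: (a - a'))) <= 4 * L ^+ 2 * delta].
Proof.
move=> L1 r0 d0 dL ah a'h xL xx' aa th.
have dx0 : 0 < enorm (a - h) - enorm (a' - h) by rewrite subr_gt0.
have xth : enorm (a' - h) * enorm (direction h a - direction h a')
    <= L * (delta * rho).
  by apply: ler_pM; rewrite ?enorm_ge0// (le_trans (ltW xx')).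
have dx : rho / 4 <= enorm (a - h) - enorm (a' - h).
  have := enorm_sub_le_direction _ _ _ ah a'h xx'; nra.
have lam0 : 0 <= lam by rewrite divr_ge0 ?enorm_ge0// ltW.
have lamL : lam <= 4 * L / rho.
  rewrite /lam ler_pdivrMr// mulrAC ler_pdivlMr//; nra.
split => //; rewrite enorm_sub_line//.
have -> : 4 * L ^+ 2 * delta = (4 * L / rho) * (L * (delta * rho)).
  by field; rewrite gt_eqF.
by apply: ler_pM => //; rewrite mulr_ge0 ?enorm_ge0.
Qed.

Lemma enorm_line_sub_le (eta rho mu M lam1 lam2 : R) (a1 a1' a2 a2' : 'rV[R]_d) :
  0 <= lam1 -> lam1 <= M -> `|lam1 - lam2| <= mu ->
  enorm (a1 - a2) <= eta -> enorm (a1' - a2') <= eta -> enorm (a2 - a2') <= rho ->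
  enorm (a1 - lam1 *: (a1 - a1') - (a2 - lam2 *: (a2 - a2')))
    <= eta + M * (2 * eta) + mu * rho.
Proof.
move=> l0 lM lmu e1 e2 er.
have -> : a1 - lam1 *: (a1 - a1') - (a2 - lam2 *: (a2 - a2')) =
    (a1 - a2) - lam1 *: ((a1 - a2) - (a1' - a2')) - (lam1 - lam2) *: (a2 - a2').
  by apply/rowP => i; rewrite !mxE; ring.
apply: le_trans (enormB _ _) (lerD (le_trans (enormB _ _) (lerD e1 _)) _).
  rewrite enormZ ger0_norm// ler_pM ?enorm_ge0//.
  by apply: le_trans (enormB _ _) _; lra.
by rewrite enormZ ler_pM ?enorm_ge0.
Qed.

Lemma aligned_centers_covered A (L rho delta s : R) n (U : 'I_n -> set 'rV[R]_d) :
  1 <= L -> 0 < rho -> rho <= 2 * L -> 0 < delta -> delta * L <= 1 / 4 ->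
  0 <= s -> (forall i, (diam (U i) <= (delta * rho)%:E)%E) ->
  A `<=` \bigcup_i U i ->
  covered_at_cost s (aligned_centers A L rho (delta * rho))
    (n%:R ^+ 2 * (5 * L / delta) * (19 * L ^+ 2 * delta) `^ s)%:E.
Proof.
move=> L1 r0 rL d0 dL s0 dU AU.
have mu0 : 0 < delta / rho by rewrite divr_gt0.
pose m := (Num.trunc (4 * L / delta)).+1.
pose lam h a a' := enorm (a - h) / (enorm (a - h) - enorm (a' - h)).
pose W (p : 'I_n * 'I_n * 'I_m) := [set h | exists a a',
  [/\ U p.1.1 a /\ U p.1.2 a', 0 <= lam h a a' /\ lam h a a' <= 4 * L / rho,
   enorm (h - (a - lam h a a' *: (a - a'))) <= 4 * L ^+ 2 * delta,
   enorm (a - a') <= rho &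
   p.2%:R * (delta / rho) <= lam h a a' /\
   lam h a a' <= p.2.+1%:R * (delta / rho)]].
have K0 : 0 <= 19 * L ^+ 2 * delta by rewrite mulr_ge0 ?(ltW d0)// mulr_ge0 ?sqr_ge0.
have dW p : (diam (W p) <= (19 * L ^+ 2 * delta)%:E)%E.
  apply: diam_le => h1 h2 [a1 [a1' [[Ua1 Ua1'] [l10 l1L] hl1 r1 [j1 j1']]]]
    [a2 [a2' [[Ua2 Ua2'] [l20 l2L] hl2 r2 [j2 j2']]]].
  apply: le_trans (enorm_distD (a1 - lam h1 a1 a1' *: (a1 - a1')) _ _) _.
  apply: le_trans (lerD hl1 (enorm_distD (a2 - lam h2 a2 a2' *: (a2 - a2')) _ _)) _.
  have mid := enorm_line_sub_le (delta * rho) rho (delta / rho) (4 * L / rho)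
    _ _ a1 a1' a2 a2' l10 l1L _ (enorm_le_diam _ _ _ _ (dU _) Ua1 Ua2)
    (enorm_le_diam _ _ _ _ (dU _) Ua1' Ua2') r2.
  have : `|lam h1 a1 a1' - lam h2 a2 a2'| <= delta / rho.
    move: j1' j2'; rewrite -!natr1 !mulrDl !mul1r => j1' j2'.
    by rewrite ler_norml; apply/andP; split; lra.
  move=> /(mid _){}mid.
  rewrite (enorm_subC _ h2); apply: le_trans (lerD (lexx _) (lerD mid hl2)) _.
  have -> : 4 * L / rho * (2 * (delta * rho)) = 8 * L * delta.
    by field; rewrite gt_eqF.
  rewrite divfK ?gt_eqF//.
  have LL : 8 * L ^+ 2 + rho + 8 * L + 1 <= 19 * L ^+ 2 by nra.
  have := ler_wpM2r (ltW d0) LL; lra.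
have := covered_at_cost_fin s _ W _ s0 K0 dW.
apply: covered_at_costW.
  move=> h [a [a' [[Aa Aa'] [ah a'h] xL xx' [lo hi th]]]].
  have [i _ Ui] := AU _ Aa; have [i' _ Ui'] := AU _ Aa'.
  have [l0 lL hl] := aligned_centers_near_line _ _ _ _ _ _ L1 r0 d0 dL ah a'h xL xx' lo th.
  rewrite -/(lam h a a') in l0 lL hl.
  have q0 : 0 <= lam h a a' / (delta / rho) by rewrite divr_ge0// ltW.
  have jm : (Num.trunc (lam h a a' / (delta / rho)) < m)%N.
    rewrite ltnS; apply: le_truncn.
    rewrite ler_pdivrMr//; apply: (le_trans lL).
    by rewrite le_eqVlt; apply/orP; left; apply/eqP; field; rewrite !gt_eqF.
  exists (i, i', Ordinal jm) => //; exists a, a'; split => //=.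
  have /andP[j1 j2] := truncn_itv q0.
  by split; [rewrite -ler_pdivlMr | rewrite -ler_pdivrMr// ltW].
rewrite lee_fin ler_wpM2r ?powR_ge0//.
rewrite !card_prod !card_ord !natrM expr2 ler_wpM2l//.
rewrite /m -natr1; apply: (@le_trans _ _ (4 * L / delta + 1)).
  by rewrite lerD2r truncn_le// divr_ge0 ?ltW//; lra.
have -> : 5 * L / delta = 4 * L / delta + L / delta by field; rewrite gt_eqF.
rewrite lerD2l ler_pdivlMr//; nra.
Qed.

End centers.

Section exceptional_centers.
Context {R : realType} {d : nat}.
Implicit Types (A : set 'rV[R]_d) (h a : 'rV[R]_d).

Lemma adherent_centers_covered A (tau delta0 s e : R) :
  0 < delta0 -> 0 < s -> tau < s -> box_covered A tau delta0 -> 0 < e ->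
  covered_at_cost s
    [set h | forall r, 0 < r -> exists a, A a /\ enorm (a - h) <= r] e%:E.
Proof.
move=> d0 s0 ts cov e0.
have [r [r0 rd re]] : exists r : R, [/\ 0 < r, r < delta0 & 3 `^ s * r `^ (s - tau) < e].
  near (0 : R)^'+ => r; exists r; split; near: r.
  - exact: nbhs_right_gt.
  - exact: nbhs_right_lt.
  - by apply: near_powR_small => //; rewrite subr_gt0.
have [n [U [nle dU AU]]] := cov _ r0 rd.
pose V i := [set h | exists a, U i a /\ enorm (a - h) <= r].
have dV i : (diam (V i) <= (3 * r)%:E)%E.
  apply: diam_le => x y [a [Ua ax]] [b [Ub bay]].
  have ab := enorm_le_diam _ _ _ _ (dU i) Ua Ub.
  have := enorm_distD a x y; have := enorm_distD b a y.
  rewrite (enorm_subC x a); lra.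
have r3 : 0 <= 3 * r by lra.
have := covered_at_cost_fin s _ V _ (ltW s0) r3 dV.
apply: covered_at_costW.
  move=> h /(_ r r0)[a [Aa ah]]; have [i _ Ui] := AU _ Aa.
  by exists i => //; exists a.
rewrite lee_fin card_ord (le_trans _ (ltW re))//.
rewrite powRM ?(ltW r0)// mulrCA ler_wpM2l ?powR_ge0//.
rewrite addrC powRD; last by rewrite (gt_eqF r0) implybT.
by rewrite ler_wpM2r ?powR_ge0.
Unshelve. all: by end_near. Qed.

Definition irregular_centers A (alpha L : R) := [set h |
  [/\ ~ A h, forall a, A a -> enorm (a - h) <= L &
   forall C, 0 <= C -> exists a a', [/\ A a, A a' &
     C * enorm (direction h a - direction h a') `^ alpha <
     enorm (a - h) - enorm (a' - h)]]].

Lemma irregular_centers_aligned A (alpha L c : R) : 0 < alpha -> 0 < c ->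
  irregular_centers A alpha L `<=` \bigcup_k aligned_centers A L
    (2 * L / 2 ^+ k) (c * (2 * L / 2 ^+ k) `^ alpha^-1).
Proof.
move=> al0 c0 h [nAh AL bad].
have [a [a' [Aa Aa' lt]]] := bad (c `^ (- alpha)) (powR_ge0 _ _).
have neq b : A b -> b != h by move=> Ab; apply: contra_not_neq nAh => <-.
have xx' : enorm (a' - h) < enorm (a - h).
  by rewrite -subr_gt0; apply: le_lt_trans lt; rewrite mulr_ge0 ?powR_ge0.
have xa := enorm_distD a' a h.
have aL : enorm (a - a') <= 2 * L.
  have := enorm_distD h a a'; rewrite (enorm_subC h).
  have := AL _ Aa; have := AL _ Aa'; lra.
have a0 : 0 < enorm (a - a') by lra.
have [k [lo hi]] := dyadic_scale _ _ a0 aL.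
exists k => //; exists a, a'; split; [by []| | exact: AL|by []|].
  by split; exact: neq.
split => //; set rho := 2 * L / 2 ^+ k in lo hi *.
have r0 : 0 <= rho by apply: le_trans hi; exact: ltW.
rewrite leNgt; apply/negP => th; move: lt; apply/negP; rewrite -leNgt.
have : (c * rho `^ alpha^-1) `^ alpha <=
    enorm (direction h a - direction h a') `^ alpha.
  apply: ge0_ler_powR; rewrite ?nnegrE ?enorm_ge0 ?(ltW al0) ?(ltW th)//.
  by rewrite mulr_ge0 ?powR_ge0 ?ltW.
have rhoE : (rho `^ alpha^-1) `^ alpha = rho.
  rewrite -powRrM mulVf ?(gt_eqF al0)//; exact: powRr1.
rewrite powRM ?powR_ge0 ?(ltW c0)// rhoE.
move=> /(ler_wpM2l (powR_ge0 c (- alpha))).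
rewrite mulrA -powRD; last by rewrite (gt_eqF c0) implybT.
rewrite addNr powRr0 mul1r; apply: le_trans; lra.
Qed.

Lemma aligned_centers_cost A (L tau delta0 w beta c rho : R) :
  1 <= L -> 0 <= tau -> 0 < w -> 1 < beta -> 0 < c -> 0 < rho -> rho <= 2 * L ->
  c * (2 * L) `^ beta < delta0 -> c * (2 * L) `^ (beta - 1) * L <= 1 / 4 ->
  box_covered A tau delta0 ->
  covered_at_cost (w + 1) (aligned_centers A L rho (c * rho `^ beta))
    (5 * L * (19 * L ^+ 2) `^ (w + 1) * c `^ (w - 2 * tau) *
     rho `^ (w * (beta - 1) - 2 * tau * beta))%:E.
Proof.
move=> L1 tau0 w0 b1 c0 r0 rL cd cL cov.
pose delta := c * rho `^ (beta - 1).
have etaE : c * rho `^ beta = delta * rho.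
  by rewrite /delta -mulrA [_ * rho]mulrC mulr_powRB1 ?ltW//; lra.
have d0 : 0 < delta by rewrite mulr_gt0 ?powR_gt0.
have mono (p : R) : 0 <= p -> c * rho `^ p <= c * (2 * L) `^ p.
  move=> p0; rewrite ler_wpM2l ?(ltW c0)//.
  by apply: ge0_ler_powR; rewrite // ?nnegrE; lra.
have eta0 : 0 < c * rho `^ beta by rewrite mulr_gt0 ?powR_gt0.
have [||n [U [nle dU AU]]] := cov (c * rho `^ beta); first by [].
  by apply: le_lt_trans cd; apply: mono; lra.
rewrite etaE in dU *.
have dL : delta * L <= 1 / 4.
  apply: le_trans cL; rewrite ler_wpM2r ?mono//; lra.
have w1 : 0 <= w + 1 by lra.
have := aligned_centers_covered A L rho delta (w + 1) n U L1 r0 rL d0 dL w1 dU AU.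
apply: covered_at_costW => //; rewrite lee_fin.
have rn (p : R) : (p == 0) ==> (rho != 0) by rewrite (gt_eqF r0) implybT.
have cn (p : R) : (p == 0) ==> (c != 0) by rewrite (gt_eqF c0) implybT.
have dn (p : R) : (p == 0) ==> (delta != 0) by rewrite (gt_eqF d0) implybT.
have n2 : n%:R ^+ 2 <= c `^ (- (2 * tau)) * rho `^ (- (2 * tau * beta)).
  have -> : c `^ (- (2 * tau)) * rho `^ (- (2 * tau * beta)) =
      ((c * rho `^ beta) `^ (- tau)) ^+ 2.
    rewrite -powR_mulrn ?powR_ge0// -powRrM powRM ?powR_ge0 ?(ltW c0)//.
    by rewrite -powRrM; congr (_ `^ _ * _ `^ _); ring.
  by rewrite ler_sqr ?nnegrE ?powR_ge0.
have dw : delta `^ w = c `^ w * rho `^ (w * (beta - 1)).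
  by rewrite /delta powRM ?powR_ge0 ?(ltW c0)// -powRrM [w * _]mulrC.
rewrite powRM ?(ltW d0)//; last by rewrite mulr_ge0 ?sqr_ge0.
rewrite (powRD (dn (w + 1))) (powRr1 (ltW d0)) dw.
rewrite (powRD (cn _)) (powRD (rn _)).
set K := (19 * _) `^ _.
rewrite (_ : n%:R ^+ 2 * _ * _ = n%:R ^+ 2 *
  (5 * L * K * (c `^ w * rho `^ (w * (beta - 1))))); last first.
  by field; rewrite gt_eqF.
apply: (@le_trans _ _ (c `^ (- (2 * tau)) * rho `^ (- (2 * tau * beta)) *
  (5 * L * K * (c `^ w * rho `^ (w * (beta - 1)))))); last first.
  rewrite le_eqVlt; apply/orP; left; apply/eqP; ring.
rewrite ler_wpM2r// !mulr_ge0 ?powR_ge0//; lra.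
Qed.

Lemma irregular_centers_covered A (L tau delta0 w alpha e : R) :
  1 <= L -> 0 <= tau -> 0 < w -> 0 < alpha -> alpha < 1 -> 0 < delta0 ->
  0 < w - 2 * tau -> 0 < w * (alpha^-1 - 1) - 2 * tau * alpha^-1 ->
  box_covered A tau delta0 -> 0 < e ->
  covered_at_cost (w + 1) (irregular_centers A alpha L) e%:E.
Proof.
move=> L1 tau0 w0 al0 al1 d0 wt.
set beta := alpha^-1; set gam := w * _ - _ => gam0 cov e0.
have b1 : 1 < beta by rewrite invf_gt1.
have L0 : 0 < 2 * L by lra.
pose z : R := 2^-1 `^ gam.
have z0 : 0 < z by rewrite powR_gt0 ?invr_gt0.
have z1 : z < 1.
  have := @gt0_ltr_powR R gam gam0 2^-1 1; rewrite powR1; apply; rewrite ?nnegrE; lra.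
pose K := 5 * L * (19 * L ^+ 2) `^ (w + 1) * (2 * L) `^ gam / (1 - z).
have [c [c0 cd cL cK]] : exists c : R, [/\ 0 < c, c * (2 * L) `^ beta < delta0,
    c * (2 * L) `^ (beta - 1) * L <= 1 / 4 & K * c `^ (w - 2 * tau) < e].
  near (0 : R)^'+ => c.
  have c0 : 0 < c by near: c; exact: nbhs_right_gt.
  exists c; split => //.
  - rewrite mulrC -[c]powRr1 ?ltW//; near: c; exact: near_powR_small.
  - rewrite -mulrA mulrC -[c in _ * c]powRr1 ?(ltW c0)//; apply: ltW; near: c.
    by apply: near_powR_small => //; lra.
  - by near: c; exact: near_powR_small.
have cost k := aligned_centers_cost A L tau delta0 w beta c (2 * L / 2 ^+ k)
  L1 tau0 w0 b1 c0.
have cover k : covered_at_cost (w + 1)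
    (aligned_centers A L (2 * L / 2 ^+ k) (c * (2 * L / 2 ^+ k) `^ beta))
    (K * (1 - z) * c `^ (w - 2 * tau) * z ^+ k)%:E.
  have -> : K * (1 - z) * c `^ (w - 2 * tau) * z ^+ k =
      5 * L * (19 * L ^+ 2) `^ (w + 1) * c `^ (w - 2 * tau) *
      (2 * L / 2 ^+ k) `^ gam.
    rewrite /K divfK; last by rewrite gt_eqF// subr_gt0.
    rewrite [(2 * L / _) `^ gam]powRM ?(ltW L0) ?invr_ge0 ?exprn_ge0//.
    have -> : (2 ^+ k)^-1 `^ gam = z ^+ k.
      by rewrite -exprVn -[2^-1 ^+ k]powR_mulrn ?invr_ge0// powRAC powR_mulrn ?powR_ge0.
    ring.
  apply: cost => //; first by rewrite divr_gt0 ?exprn_gt0.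
  by rewrite ler_pdivrMr ?exprn_gt0// ler_peMr ?(ltW L0)// exprn_ege1// ler1n.
have := covered_at_cost_bigcup _ _ _ cover.
apply: covered_at_costW; first exact: irregular_centers_aligned.
have K0 : 0 <= K.
  rewrite /K divr_ge0 ?subr_ge0 ?(ltW z1)// !mulr_ge0 ?powR_ge0//; lra.
apply: le_trans (nneseries_geometric_le _ _ _ z0 z1) _.
  by rewrite mulr_ge0 ?powR_ge0// mulr_ge0// subr_ge0 ltW.
rewrite lee_fin (_ : _ / _ = K * c `^ (w - 2 * tau)) ?(ltW cK)//.
by field; rewrite gt_eqF// subr_gt0.
Unshelve. all: by end_near. Qed.

Lemma exceptional_center_cases A (alpha : R) : 0 < alpha -> alpha <= 1 ->
  bounded_set A ->
  [set h | ~ A h /\ ~ in_polar_holder_graph alpha A h] `<=`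
  [set h | forall r, 0 < r -> exists a, A a /\ enorm (a - h) <= r] `|`
  \bigcup_n irregular_centers A alpha n.+1%:R.
Proof.
move=> al0 al1 [M [_ AM]] h [nAh nG].
have {}AM a : A a -> enorm a <= d%:R * (M + 1).
  move=> Aa; apply: le_trans (enorm_le_norm a) _.
  by rewrite ler_wpM2l//; apply: (AM (M + 1)) Aa; rewrite ltrDl.
apply: contrapT => /not_orP[nclose nirr]; apply: nG.
have [r [r0 rA]] : exists r, 0 < r /\ forall a, A a -> r <= enorm (a - h).
  apply: contrapT => nr; apply: nclose => r r0; apply: contrapT => na.
  apply: nr; exists r; split => // a Aa; rewrite leNgt; apply/negP => ar.
  by apply: na; exists a; split => //; exact: ltW.
pose N := Num.trunc (d%:R * (M + 1) + enorm h).
have AN a : A a -> enorm (a - h) <= N.+1%:R.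
  move=> Aa; apply: le_trans (enormB _ _) _.
  apply: (@le_trans _ _ (d%:R * (M + 1) + enorm h)); first by rewrite lerD2r AM.
  exact/ltW/truncnS_gt.
have [C [C0 CA]] : exists C : R, 0 <= C /\ forall a a', A a -> A a' ->
    enorm (a - h) - enorm (a' - h) <=
    C * enorm (direction h a - direction h a') `^ alpha.
  apply: contrapT => nC; apply: nirr; exists N => //; split => // C C0.
  apply: contrapT => na; apply: nC; exists C; split => // a a' Aa Aa'.
  by rewrite leNgt; apply/negP => lt; apply: na; exists a, a'.
exact: (in_polar_holder_graph_of_bound alpha r C).
Qed.

End exceptional_centers.

Theorem theorem3p4 (R : realType) (d : nat) (A : set 'rV[R]_d) (t w : R)
  (hA : bounded_set A)
  (hdim : (upper_box_dim A < t%:E)%E)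
  (ht : t < (d%:R - 1) / 2)
  (htw : 2 * t < w)
  (hw : w < d%:R - 1) :
  (hausdorff_dim
     [set h : 'rV[R]_d | ~ A h /\ ~ in_polar_holder_graph (1 - 2 * t / w) A h]
   <= (w + 1)%:E)%E.
Proof.
have [tau [delta0 [tau0 taut d0 cov]]] : exists tau delta0 : R,
    [/\ 0 <= tau, tau < t, 0 < delta0 & box_covered A tau delta0].
  have [A0|/set0P] := eqVneq A set0; last by move=> /upper_box_dim_lt; apply.
  move: hdim; rewrite /upper_box_dim A0 eqxx lte_fin => t0.
  exists 0, 1; split => // delta _ _; exists 0, (fun=> set0).
  by split => [||x //]; [rewrite powR_ge0 | case].
have w0 : 0 < w by lra.
set alpha := 1 - 2 * t / w.
have tw : 2 * t / w < 1 by rewrite ltr_pdivrMr ?mul1r.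
have tw0 : 0 < 2 * t / w by rewrite divr_gt0//; lra.
have al0 : 0 < alpha by rewrite /alpha; lra.
have al1 : alpha < 1 by rewrite /alpha; lra.
have gam0 : 0 < w * (alpha^-1 - 1) - 2 * tau * alpha^-1.
  have -> : w * (alpha^-1 - 1) - 2 * tau * alpha^-1 = 2 * (t - tau) / alpha.
    rewrite /alpha; field; by rewrite !gt_eqF//; lra.
  by rewrite divr_gt0//; lra.
apply: ereal_inf_lbound; exists (w + 1) => //; split; first by lra.
apply: hausdorff_measure_eq0; first by lra.
move=> e e0.
pose F n := if n is k.+1 then irregular_centers A alpha k.+1%:R else
  [set h | forall r, 0 < r -> exists a, A a /\ enorm (a - h) <= r].
have covF n : covered_at_cost (w + 1) (F n) (e / 2 * 2^-1 ^+ n)%:E.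
  have en : 0 < e / 2 * 2^-1 ^+ n by rewrite mulr_gt0 ?exprn_gt0//; lra.
  case: n en => [|k] en.
    by apply: (adherent_centers_covered _ tau delta0) => //; lra.
  by apply: (irregular_centers_covered _ _ tau delta0) => //; rewrite ?ler1n//; lra.
have := covered_at_cost_bigcup _ _ _ covF; apply: covered_at_costW.
  apply: subset_trans (exceptional_center_cases _ _ al0 (ltW al1) hA) _.
  by move=> h [hc|[k _ hk]]; [exists 0|exists k.+1].
have e2 : 0 <= e / 2 by lra.
apply: le_trans (nneseries_geometric_le _ _ e2 _ _) _; [lra|lra|].
by rewrite lee_fin (_ : _ / _ = e)//; field.
Qed.
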